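(* Let $(\Omega,\mathcal{H},\hat{\mathbb{E}})$ be a sub-linear expectation space with associated upper capacity $\mathbb{V}$ and conjugate expectation $\hat{\varepsilon}$. Let $1<p\leq2$. (1) If $\{X_n,n\geq1\}\subset\mathcal{H}$ is a sequence of upper extended negatively dependent random variables with dominating constant $K\geq1$, such that $\hat{\mathbb{E}}[X_n]\leq0$ for each $n\geq1$, then for any $x>0$ and every $n\ge1$ $$\mathbb{V}\left(\sum_{i=1}^{n}X_i>x\right)\leq 4^{p}(1+Ke)x^{-p}\sum_{i=1}^{n}\hat{\mathbb{E}}[|X_i|^{p}].$$ (2) If $\{X_n,n\geq1\}\subset\mathcal{H}$ is a sequence of extended negatively dependent (END) random variables with dominating constant $K\geq1$, such that $\hat{\mathbb{E}}[X_n]=\hat{\varepsilon}[X_n]=0$ for each $n\geq1$, then for any $x>0$ and every $n\ge1$ $$\mathbb{V}\left(\left|\sum_{i=1}^{n}X_i\right|>x\right)\leq 2^{2p+1}(1+Ke)x^{-p}\sum_{i=1}^{n}\hat{\mathbb{E}}[|X_i|^{p}].$$ Here $e$ is the base of the natural logarithm.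
   Context: Setting. $(\Omega,\mathcal{F})$ is a measurable space and $\mathcal{H}$ is a linear space of real functions on $(\Omega,\mathcal{F})$ (called random variables) such that $X_1,\dots,X_n\in\mathcal{H}$ implies $\varphi(X_1,\dots,X_n)\in\mathcal{H}$ for each $\varphi\in C_{l,Lip}(\mathbb{R}^n)$, where $C_{l,Lip}(\mathbb{R}^n)$ is the space of functions $\varphi$ with $|\varphi(x)-\varphi(y)|\leq C(1+|x|^m+|y|^m)|x-y|$ for all $x,y\in\mathbb{R}^n$, for some $C>0$, $m\in\mathbb{N}$ depending on $\varphi$. $C_{b,Lip}(\mathbb{R}^n)$ is the space of functions with $|\varphi(x)|\leq C$ and $|\varphi(x)-\varphi(y)|\leq C|x-y|$ for all $x,y$, for some $C>0$ depending on $\varphi$. Sub-linear expectation. $\hat{\mathbb{E}}:\mathcal{H}\to[-\infty,+\infty]$ satisfies, for all $X,Y\in\mathcal{H}$: (a) $X\geq Y$ implies $\hat{\mathbb{E}}[X]\geq\hat{\mathbb{E}}[Y]$; (b) $\hat{\mathbb{E}}[c]=c$ for constants $c$; (c) $\hat{\mathbb{E}}[X+Y]\leq\hat{\mathbb{E}}[X]+\hat{\mathbb{E}}[Y]$ whenever the right side is not of the form $+\infty-\infty$ or $-\infty+\infty$; (d) $\hat{\mathbb{E}}[\lambda X]=\lambda\hat{\mathbb{E}}[X]$ for $\lambda>0$. The triple $(\Omega,\mathcal{H},\hat{\mathbb{E}})$ is a sub-linear expectation space. The conjugate expectation is $\hat{\varepsilon}[X]:=-\hat{\mathbb{E}}[-X]$.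 Capacity. For $A\in\mathcal{F}$, $\mathbb{V}(A)=\inf\{\hat{\mathbb{E}}[\xi]: I_A\leq\xi,\ \xi\in\mathcal{H}\}$, where $I_A$ is the indicator function of $A$. Extended negative dependence. A sequence $\{X_n,n\geq1\}\subset\mathcal{H}$ is upper (resp. lower) extended negatively dependent if there is a dominating constant $K\geq1$ such that $\hat{\mathbb{E}}\left[\prod_{i=1}^{n}f_i(X_i)\right]\leq K\prod_{i=1}^{n}\hat{\mathbb{E}}[f_i(X_i)]$ for all $n\geq1$, whenever the non-negative functions $f_i\in C_{b,Lip}(\mathbb{R})$, $i=1,2,\dots$, are all non-decreasing (resp. all non-increasing). The sequence is END if it is both upper and lower extended negatively dependent; its dominating constant $K$ is one for which both the upper and the lower inequality hold. *)

(* Defs.v *)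
From HB Require Import structures.
From mathcomp Require Import all_boot all_order all_algebra.
From mathcomp Require Import all_classical all_reals all_analysis.
Import Order.TTheory GRing.Theory Num.Theory.
Import numFieldNormedType.Exports.

Set Implicit Arguments.
Unset Strict Implicit.
Unset Printing Implicit Defensive.

Local Open Scope classical_set_scope.
Local Open Scope ring_scope.

(* The canonical norm of 'rV[R]_n in the library is the sup norm. *)
Definition euclid_norm (R : realType) (n : nat) (x : 'rV[R]_n) : R :=
  Num.sqrt (\sum_(j < n) x ord0 j ^+ 2).

(* The class C_{l,Lip}(R^n). *)
Definition locally_lipschitz_poly (R : realType) (n : nat)
    (phi : 'rV[R]_n -> R) : Prop :=
  exists (C : R) (m : nat), 0 < C /\
    forall x y : 'rV[R]_n,
      `|phi x - phi y| <=
        C * (1 + euclid_norm x ^+ m + euclid_norm y ^+ m) * euclid_norm (x - y).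

(* The class C_{b,Lip}(R). *)
Definition bounded_lipschitz (R : realType) (f : R -> R) : Prop :=
  exists C : R, [/\ 0 < C,
    forall x, `|f x| <= C &
    forall x y, `|f x - f y| <= C * `|x - y|].

Record is_random_variable_space d (T : measurableType d) (R : realType)
    (H : set (T -> R)) : Prop := {
  rvspace0 : H (fun=> 0);
  rvspaceD : forall X Y : T -> R, H X -> H Y -> H (fun w => X w + Y w);
  rvspaceZ : forall (a : R) (X : T -> R), H X -> H (fun w => a * X w);
  rvspace_comp : forall (n : nat) (X : 'I_n -> T -> R) (phi : 'rV[R]_n -> R),
    (forall j, H (X j)) -> locally_lipschitz_poly phi ->
    H (fun w => phi (\row_(j < n) X j w)) }.

(* E is total on T -> R, but only its values on H are constrained or used. *)
Record is_sublinear_expectation_space d (T : measurableType d) (R : realType)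
    (H : set (T -> R)) (E : (T -> R) -> \bar R) : Prop := {
  sle_space : is_random_variable_space H;
  sle_mono : forall X Y : T -> R, H X -> H Y ->
    (forall w, Y w <= X w) -> (E Y <= E X)%E;
  sle_cst : forall c : R, E (fun=> c) = c%:E;
  sle_subadd : forall X Y : T -> R, H X -> H Y ->
    (E X +? E Y)%E -> (E (fun w => X w + Y w)%R <= E X + E Y)%E;
  sle_homog : forall (l : R) (X : T -> R), H X -> 0 < l ->
    E (fun w => l * X w)%R = (l%:E * E X)%E }.

Definition conj_expectation d (T : measurableType d) (R : realType)
    (E : (T -> R) -> \bar R) (X : T -> R) : \bar R :=
  (- E (fun w => - X w)%R)%E.

Definition upper_capacity d (T : measurableType d) (R : realType)
    (H : set (T -> R)) (E : (T -> R) -> \bar R) (A : set T) : \bar R :=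
  ereal_inf [set E xi | xi in [set xi | H xi /\ forall w, \1_A w <= xi w]].

(* Sequences are indexed from 0: the variable X_i, i >= 1, is X (i - 1). *)
Definition END_inequality d (T : measurableType d) (R : realType)
    (E : (T -> R) -> \bar R) (K : R) (X : nat -> T -> R)
    (mono : (R -> R) -> Prop) : Prop :=
  forall (n : nat) (f : nat -> R -> R), (0 < n)%N ->
    (forall i, [/\ bounded_lipschitz (f i), (forall x, 0 <= f i x)
                 & mono (f i)]) ->
    (E (fun w => \prod_(i < n) f i (X i w))%R <=
       K%:E * \prod_(i < n) E (fun w => f i (X i w)))%E.

Definition upper_END d (T : measurableType d) (R : realType)
    (E : (T -> R) -> \bar R) (K : R) (X : nat -> T -> R) : Prop :=
  1 <= K /\ END_inequality E K X (fun f => {homo f : x y / x <= y}).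

Definition lower_END d (T : measurableType d) (R : realType)
    (E : (T -> R) -> \bar R) (K : R) (X : nat -> T -> R) : Prop :=
  1 <= K /\ END_inequality E K X (fun f => {homo f : x y / x <= y >-> y <= x}).

Definition END d (T : measurableType d) (R : realType)
    (E : (T -> R) -> \bar R) (K : R) (X : nat -> T -> R) : Prop :=
  upper_END E K X /\ lower_END E K X.

(* Main.v *)
(* Fuk-Nagaev argument.  Let B > 0 bound sum E|X_i|^p and choose L with
   e^L = x^p / B (if B >= x^p the constant 1 is already an admissible majorant).
   The function f(t) = exp(L min(t/x, 1)) is bounded, Lipschitz, nondecreasing and
   satisfies f(t) <= 1 + L t/x + e^L |t/x|^p for all t, so
   E f(X_i) <= exp(E|X_i|^p / B).  By extended negative dependence the product of
   the f(X_i) has expectation at most K e, and the indicator of {sum X_i > x} is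
   bounded by x^-p sum |X_i|^p + e^-L prod f(X_i).  This gives the constant
   1 + K e, without the factor 4^p.  Part (2) applies the bound to X and to -X. *)
Require Import Defs.
From mathcomp Require Import all_boot all_order all_algebra.
From mathcomp Require Import all_classical all_reals all_analysis.
From mathcomp Require Import ring lra.
Import Order.TTheory GRing.Theory Num.Theory.
Import numFieldNormedType.Exports.
Local Open Scope classical_set_scope.
Local Open Scope ring_scope.

Set Implicit Arguments.
Unset Strict Implicit.
Unset Printing Implicit Defensive.

(** * Exponential and power inequalities on the real line *)

(* The derivative in [L] of the difference is nonnegative: for [0 <= s] by convexity
   of [expR], for [s <= 0] by [1 + u <= expR u]. *)
Lemma expR_le_quadratic (R : realType) (L s : R) : 0 <= L -> s <= 1 ->
  expR (L * s) <= 1 + L * s + expR L * s ^+ 2.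
Proof.
move=> L0 s1.
pose h (t : R) := expR t * s ^+ 2 + 1 + t * s - expR (t * s).
pose dh (t : R) := expR t * s ^+ 2 + s - expR (t * s) * s.
have hd (t : R) : is_derive t 1 h (dh t).
  rewrite /h /dh; apply: is_derive_eq.
  by rewrite !scaler0 add0r !addr0 /GRing.scale /=; ring.
have dh_ge0 (t : R) : 0 <= t -> 0 <= dh t.
  move=> t0; rewrite /dh.
  have -> : expR t * s ^+ 2 + s - expR (t * s) * s
    = s * (s * expR t + 1 - expR (t * s)) by ring.
  have [s0|s0] := leP 0 s.
    apply: mulr_ge0 => //.
    pose S : {i01 R} := Itv01 s0 s1.
    have : expR (s * t + (1 - s) * 0) <= s * expR t + (1 - s) * expR 0.
      exact: (@convex_expR R S t 0).
    by rewrite mulr0 addr0 expR0 mulr1 (mulrC s); lra.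
  have := expR_ge1Dx (t * s); have := expR_ge1Dx t; nra.
have hc : continuous h.
  by move=> t; apply/differentiable_continuous/derivable1_diffP/ex_derive.
have [c] := MVT_segment L0 (fun t _ => hd t) (continuous_subspaceT hc).
rewrite in_itv /= => /andP[c0 _] e.
have : 0 <= h L - h 0 by rewrite e subr0 mulr_ge0 ?dh_ge0.
rewrite /h mul0r expR0; have := sqr_ge0 s; lra.
Qed.

(** When [|s| <= 1], the exponent [p <= 2] gives [s ^+ 2 <= |s|^p], so the quadratic bound suffices.
    When [s < -1], the left side is at most 1, and [L <= expR L] with [|s| <= |s|^p] makes the
    remaining terms on the right nonnegative together. *)
Lemma expR_le_powR (R : realType) (p L s : R) : 1 <= p <= 2 -> 0 <= L -> s <= 1 ->
  expR (L * s) <= 1 + L * s + expR L * `|s| `^ p.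
Proof.
move=> /andP[p1 p2] L0 s1.
have [s_small|s_large] := leP `|s| 1.
  apply: (le_trans (expR_le_quadratic L0 s1)).
  rewrite lerD2l ler_wpM2l ?expR_ge0//.
  have [->|s0] := eqVneq s 0; first by rewrite expr0n /= powR_ge0.
  rewrite -(real_normK (num_real s)) -powR_mulrn//.
  have s0' : 0 < `|s| by rewrite normr_gt0.
  rewrite !/(powR _ _) !gt_eqF//= ler_expR.
  by apply: ler_wnM2r => //; exact: ln_le0.
have sN : s < 0 by rewrite ltNge; apply/negP => s0; rewrite ger0_norm // in s_large; lra.
have e1 : expR (L * s) <= 1 by rewrite -[leRHS]expR0 ler_expR; nra.
have e2 : L <= expR L by have := expR_ge1Dx L; lra.
have e3 : `|s| <= `|s| `^ p by apply: le1r_powR => //; exact: ltW.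
have e4 : L * `|s| <= expR L * `|s| `^ p by apply: ler_pM.
rewrite ltr0_norm // in e4 *; lra.
Qed.

(** Beyond [s = 1] the left side is frozen at its value there, while the right side keeps
    increasing. *)
Lemma expR_minr_le_powR (R : realType) (p L s : R) : 1 <= p <= 2 -> 0 <= L ->
  expR (L * Num.min s 1) <= 1 + L * s + expR L * `|s| `^ p.
Proof.
move=> p12 L0.
have [s1|s1] := leP s 1; first exact: expR_le_powR.
apply: (le_trans (expR_le_powR p12 L0 (lexx 1))).
rewrite normr1; apply: lerD; first nra.
rewrite ler_pM2l ?expR_gt0//; case/andP: p12 => p1 p2.
rewrite (@ger0_norm _ s); last lra.
apply: ge0_ler_powR; rewrite ?nnegrE; lra.
Qed.

(** With [r = b / a] in [0, 1], [r ^+ 2 <= r^p] yields [1 - r^p <= 1 - r ^+ 2 <= 2 * (1 - r)].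
    Multiplying by [a^p = a * a^(p-1)] and using [a^(p-1) <= 1 + a], which holds because [p - 1]
    lies in [0, 1], gives the bound. It serves to place [|X|^p] in [H]. *)
Lemma powR_sub_le (R : realType) (p a b : R) : 1 <= p <= 2 -> 0 <= b -> b <= a ->
  a `^ p - b `^ p <= 2 * (1 + a) * (a - b).
Proof.
move=> /andP[p1 p2] b0 ba.
have a0 : 0 <= a by lra.
have [aE|aN0] := eqVneq a 0.
  by (have -> : b = a by lra); rewrite !subrr mulr0.
have {aN0} a0' : 0 < a by rewrite lt_def aN0.
pose r := b / a.
have r0 : 0 <= r by rewrite divr_ge0.
have r1 : r <= 1 by rewrite ler_pdivrMr// mul1r.
have bE : b = a * r by rewrite /r mulrCA divff ?mulr1// gt_eqF.
have hr : r ^+ 2 <= r `^ p.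
  rewrite -powR_mulrn//; have [r00|rN0] := eqVneq r 0.
    by rewrite r00 powR0 ?powR_ge0.
  rewrite !/(powR _ _) (negbTE rN0) ler_expR.
  by apply: ler_wnM2r => //; exact: ln_le0.
have apE : a `^ p = a * a `^ (p - 1) by rewrite mulr_powRB1//; lra.
have ap : a `^ (p - 1) <= 1 + a.
  have [a1|a1] := leP 1 a.
    have : a `^ (p - 1) <= a by apply: ler1_powR => //; lra.
    lra.
  have : a `^ (p - 1) <= 1 `^ (p - 1) by apply: ge0_ler_powR; rewrite ?nnegrE; lra.
  rewrite powR1; lra.
have ap0 := powR_ge0 a p.
rewrite bE powRM//.
apply: (@le_trans _ _ (a `^ p * (2 * (1 - r)))).
  by rewrite -[X in X - _]mulr1 -mulrBr ler_wpM2l//; nra.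
rewrite apE.
have -> : a * a `^ (p - 1) * (2 * (1 - r)) = a `^ (p - 1) * (2 * (a - a * r)) by ring.
have -> : 2 * (1 + a) * (a - a * r) = (1 + a) * (2 * (a - a * r)) by ring.
by apply: ler_wpM2r => //; nra.
Qed.

Lemma norm_powR_locally_lipschitz (R : realType) (p x y : R) : 1 <= p <= 2 ->
  `| `|x| `^ p - `|y| `^ p | <= 2 * (1 + `|x| + `|y|) * `|x - y|.
Proof.
move=> p12; wlog le_yx : x y / `|y| <= `|x|.
  move=> hw; have [yx|/ltW xy] := leP `|y| `|x|; first exact: hw.
  by rewrite distrC (distrC x) -addrA (addrC `|x|) addrA; exact: hw.
have p0 : 0 <= p by case/andP: p12; lra.
rewrite ger0_norm ?subr_ge0 ?ge0_ler_powR ?nnegrE//.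
apply: (le_trans (powR_sub_le p12 (normr_ge0 y) le_yx)).
have := lerB_dist x y; have := normr_ge0 x; have := normr_ge0 y.
have := normr_ge0 (x - y); nra.
Qed.

Lemma expR_sub_le (R : realType) (a b : R) : b <= a ->
  expR a - expR b <= expR a * (a - b).
Proof.
move=> ba; have := expR_ge1Dx (b - a).
have -> : expR b = expR a * expR (b - a) by rewrite -expRD addrC subrK.
have := expR_gt0 a; nra.
Qed.

Lemma bounded_lipschitz_expR_minr (R : realType) (L x : R) : 0 <= L -> 0 < x ->
  bounded_lipschitz (fun t => expR (L * Num.min (t / x) 1)).
Proof.
move=> L0 x0.
have bnd (t : R) : expR (L * Num.min (t / x) 1) <= expR L.
  by rewrite ler_expR -[leRHS]mulr1 ler_wpM2l// ge_min lexx orbT.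
have Lx : 0 <= L / x by rewrite divr_ge0// ltW.
(* One constant dominates both the supremum [expR L] and the Lipschitz constant
   [expR L * (L / x)]. *)
exists (expR L * (1 + L / x)); split.
- by rewrite mulr_gt0 ?expR_gt0//; lra.
- move=> t; rewrite ger0_norm ?expR_ge0//; apply: (le_trans (bnd t)).
  by rewrite ler_peMr ?expR_ge0// lerDl.
move=> s t; wlog le_ts : s t / t <= s.
  move=> hw; have [ts|/ltW st] := leP t s; first exact: hw.
  by rewrite distrC (distrC s); exact: hw.
have le_x : t / x <= s / x by rewrite ler_pM2r ?invr_gt0.
have le_m : Num.min (t / x) 1 <= Num.min (s / x) 1.
  by rewrite le_min !ge_min le_x lexx orbT.
rewrite ger0_norm ?subr_ge0 ?ler_expR ?ler_wpM2l//.
apply: (le_trans (expR_sub_le _)); first by rewrite ler_wpM2l.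
rewrite ger0_norm ?subr_ge0// -mulrA; apply: ler_pM => //.
  by rewrite subr_ge0 ler_wpM2l.
(* Truncation at 1 does not enlarge increments. *)
have : Num.min (s / x) 1 - Num.min (t / x) 1 <= s / x - t / x.
  by case: (leP (s / x) 1); case: (leP (t / x) 1); lra.
have -> : (1 + L / x) * (s - t) = (s - t) + L * (s / x - t / x) by ring.
rewrite -mulrBr; nra.
Qed.

(** * Closure properties of the space of random variables *)

Lemma normr_le_euclid_norm (R : realType) (n : nat) (x : 'rV[R]_n) (j : 'I_n) :
  `|x ord0 j| <= euclid_norm x.
Proof.
rewrite /euclid_norm -sqrtr_sqr ler_wsqrtr// (bigD1 j)//= lerDl.
by apply: sumr_ge0 => i _; exact: sqr_ge0.
Qed.

Lemma euclid_norm1 (R : realType) (x : 'rV[R]_1) : euclid_norm x = `|x ord0 ord0|.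
Proof. by rewrite /euclid_norm big_ord1 sqrtr_sqr. Qed.

Section random_variable_space.
Context d (T : measurableType d) (R : realType) (H : set (T -> R)).
Hypothesis H_space : is_random_variable_space H.

(** A real argument is a row vector of length one, whose Euclidean norm is the absolute value. *)
Lemma rvspace_comp1 (C : R) (m : nat) (f : R -> R) (X : T -> R) : 0 < C ->
  (forall x y, `|f x - f y| <= C * (1 + `|x| ^+ m + `|y| ^+ m) * `|x - y|) ->
  H X -> H (fun w => f (X w)).
Proof.
move=> C0 fC HX.
have -> : (fun w => f (X w)) =
    (fun w => f ((\row_(j < 1) X w) ord0 ord0)).
  by apply/funext => w; rewrite mxE.
apply: (rvspace_comp H_space (X := fun=> X)
  (phi := fun v : 'rV[R]_1 => f (v ord0 ord0))) => //.
by exists C, m; split=> // x y; rewrite !euclid_norm1 !mxE; exact: fC.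
Qed.

Lemma rvspace_lipschitz (f : R -> R) (X : T -> R) :
  bounded_lipschitz f -> H X -> H (fun w => f (X w)).
Proof.
(* With exponent 0 the growth factor is the constant 3, which only weakens the Lipschitz bound. *)
move=> [C [C0 _ fC]]; apply: (@rvspace_comp1 C 0) => // x y.
by rewrite !expr0 (le_trans (fC x y))// ler_wpM2r// ler_peMr ?ltW//; lra.
Qed.

Lemma rvspace_cst (c : R) : H (fun=> c).
Proof.
apply: (rvspace_lipschitz (f := fun=> c) (X := fun=> 0)); last exact: rvspace0.
(* The added 1 keeps the constant positive when [c = 0]. *)
exists (`|c| + 1); split=> [|_|x y]; first by have := normr_ge0 c; lra.
  by rewrite lerDl.
by rewrite subrr normr0 mulr_ge0// addr_ge0.
Qed.

Lemma rvspace_norm_powR (p : R) (X : T -> R) : 1 <= p <= 2 ->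
  H X -> H (fun w => `|X w| `^ p).
Proof.
move=> p12; apply: (@rvspace_comp1 2 1 (fun x => `|x| `^ p)) => // x y.
by rewrite !expr1; exact: norm_powR_locally_lipschitz.
Qed.

(** The product of two coordinates is locally Lipschitz with linear growth: split its increment into
    two terms, each a coordinate of [x] or [y] times a coordinate of [x - y]. *)
Lemma rvspaceM (X Y : T -> R) : H X -> H Y -> H (fun w => X w * Y w).
Proof.
move=> HX HY.
pose Z (j : 'I_2) := if j == ord0 then X else Y.
have -> : (fun w => X w * Y w) = (fun w =>
    (\row_(j < 2) Z j w) ord0 ord0 * (\row_(j < 2) Z j w) ord0 (lift ord0 ord0)).
  by apply/funext => w; rewrite !mxE.
apply: (rvspace_comp H_space (X := Z)
    (phi := fun v : 'rV[R]_2 => v ord0 ord0 * v ord0 (lift ord0 ord0))).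
  by move=> j; rewrite /Z; case: ifP.
exists 1, 1; split=> // x y; rewrite !expr1 mul1r.
pose k : 'I_1 := ord0; pose i : 'I_2 := ord0; pose j : 'I_2 := lift ord0 ord0.
rewrite -/k -/i -/j.
have -> : x k i * x k j - y k i * y k j
  = x k i * (x - y) k j + y k j * (x - y) k i by rewrite !mxE; ring.
apply: (le_trans (ler_normD _ _)); rewrite !normrM.
have e1 := normr_le_euclid_norm x i; have e2 := normr_le_euclid_norm y j.
have e3 := normr_le_euclid_norm (x - y) i.
have e4 := normr_le_euclid_norm (x - y) j.
have p1 := ler_pM (normr_ge0 _) (normr_ge0 _) e1 e4.
have p2 := ler_pM (normr_ge0 _) (normr_ge0 _) e2 e3.
have : 0 <= euclid_norm (x - y) by exact: sqrtr_ge0.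
lra.
Qed.

Lemma rvspace_prod (n : nat) (F : 'I_n -> T -> R) :
  (forall i, H (F i)) -> H (fun w => \prod_(i < n) F i w).
Proof.
elim: n F => [F _|n IH F HF].
  by under eq_fun do rewrite big_ord0; exact: rvspace_cst.
under eq_fun do rewrite big_ord_recr /=.
by apply: rvspaceM => //; exact: IH.
Qed.

Lemma rvspace_sum (n : nat) (F : 'I_n -> T -> R) :
  (forall i, H (F i)) -> H (fun w => \sum_(i < n) F i w).
Proof.
elim: n F => [F _|n IH F HF].
  by under eq_fun do rewrite big_ord0; exact: rvspace_cst.
under eq_fun do rewrite big_ord_recr /=.
by apply: rvspaceD => //; exact: IH.
Qed.

End random_variable_space.

(** * Expectations of sums and of the truncated exponential *)

Lemma prode_le_EFin (R : realType) (n : nat) (a : 'I_n -> \bar R) (b : 'I_n -> R) :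
  (forall i, 0 <= a i <= (b i)%:E)%E ->
  (\prod_(i < n) a i <= (\prod_(i < n) b i)%:E)%E.
Proof.
elim: n a b => [a b _|n IH a b ab]; first by rewrite !big_ord0.
rewrite !big_ord_recr /= EFinM; apply: lee_pmul.
- by apply: prode_ge0 => i _; case/andP: (ab (widen_ord (leqnSn n) i)).
- by case/andP: (ab ord_max).
- exact: IH.
- by case/andP: (ab ord_max).
Qed.

Section sublinear_expectation.
Context d (T : measurableType d) (R : realType).
Context (H : set (T -> R)) (E : (T -> R) -> \bar R).
Hypothesis hE : is_sublinear_expectation_space H E.
Let HH : is_random_variable_space H := sle_space hE.

Lemma sle_ge0 (X : T -> R) : H X -> (forall w, 0 <= X w) -> (0 <= E X)%E.
Proof.
move=> HX X0; have <- : E (fun=> 0) = 0%E by exact: (sle_cst hE).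
by apply: (sle_mono hE) => //; exact: rvspace_cst.
Qed.

Lemma sle_subadd_fin (X Y : T -> R) : H X -> H Y -> (E Y \is a fin_num) ->
  (E (fun w => X w + Y w)%R <= E X + E Y)%E.
Proof. by move=> HX HY EY; apply: (sle_subadd hE) => //; exact: fin_num_adde_defl. Qed.

(** Nonnegativity of the terms rules out opposite infinities at every use of subadditivity, so
    infinite expectations are allowed. *)
Lemma sle_sum (n : nat) (F : 'I_n -> T -> R) :
  (forall i, H (F i)) -> (forall i w, 0 <= F i w) ->
  (E (fun w => \sum_(i < n) F i w)%R <= \sum_(i < n) E (F i))%E.
Proof.
elim: n F => [F _ _|n IH F HF F0].
  by under eq_fun do rewrite big_ord0; rewrite (sle_cst hE) big_ord0.
under eq_fun do rewrite big_ord_recr /=.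
rewrite big_ord_recr /=.
set G := fun w => \sum_(i < n) F (widen_ord (leqnSn n) i) w.
have HG : H G by apply: (rvspace_sum HH) => i; exact: HF.
have G0 : (0 <= E G)%E by apply: sle_ge0 => // w; apply: sumr_ge0 => i _; exact: F0.
apply: (le_trans (sle_subadd hE HG (HF _) _)).
  by apply: ge0_adde_def; rewrite inE// sle_ge0.
by apply: leeD => //; exact: IH.
Qed.

(** Take expectations in the pointwise bound at [s = X / x]: the linear term contributes at most 0,
    and [1 + u <= expR u] puts the result in a form that multiplies well. Here [e] is the p-th
    absolute moment. *)
Lemma sle_expR_minr (p L x e : R) (X : T -> R) : 1 <= p <= 2 -> 0 < L -> 0 < x ->
  H X -> (E X <= 0)%E -> E (fun w => `|X w| `^ p) = e%:E ->
  (E (fun w => expR (L * Num.min (X w / x) 1))%R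
     <= (expR (expR L * x `^ (- p) * e))%:E)%E.
Proof.
move=> p12 L0 x0 HX EX0 EXp.
set c := expR L * x `^ (- p).
have c0 : 0 < c by rewrite mulr_gt0 ?expR_gt0 ?powR_gt0.
have Lx0 : 0 < L / x by rewrite divr_gt0.
have HXp : H (fun w => `|X w| `^ p) by exact: rvspace_norm_powR.
have HY : H (fun w => L / x * X w) by exact: rvspaceZ.
have HcXp : H (fun w => c * `|X w| `^ p) by exact: rvspaceZ.
have H1 := rvspace_cst HH 1.
have H1Y : H (fun w => L / x * X w + 1) by exact: rvspaceD.
have EcXp : E (fun w => c * `|X w| `^ p) = (c * e)%:E.
  by rewrite (sle_homog hE)// EXp EFinM.
(* [E X] may be minus infinity, so subadditivity is always applied with the other summand finite:
   first the constant 1, then the p-th power term. *)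
have EY : (E (fun w => (L / x * X w + 1)%R) <= 1%:E)%E.
  apply: (le_trans (sle_subadd_fin HY H1 _)); rewrite (sle_cst hE)//.
  rewrite (sle_homog hE)// -[leRHS]add0e leeD2r//.
  by apply: mule_ge0_le0 => //; rewrite lee_fin ltW.
apply: (@le_trans _ _ (E (fun w => (L / x * X w + 1) + c * `|X w| `^ p)%R)).
  apply: (sle_mono hE).
  - exact: (rvspaceD HH H1Y HcXp).
  - apply: (rvspace_lipschitz HH (f := fun t => expR (L * Num.min (t / x) 1))) => //.
    by apply: bounded_lipschitz_expR_minr => //; exact: ltW.
  move=> w; apply: (le_trans (expR_minr_le_powR (X w / x) p12 (ltW L0))).
  have -> : `|X w / x| `^ p = `|X w| `^ p * x `^ (- p).
    have xN0 := ltW x0; have xV : `|x^-1| = x `^ (-1).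
      by rewrite powR_inv1// ger0_norm// invr_ge0.
    by rewrite normrM powRM// xV -powRrM mulN1r.
  rewrite le_eqVlt; apply/orP; left; apply/eqP; rewrite /c; ring.
apply: (le_trans (sle_subadd_fin H1Y HcXp _)); rewrite EcXp//.
apply: (le_trans (leeD2r _ EY)).
by rewrite -EFinD lee_fin expR_ge1Dx.
Qed.

(** * The majorant of the one-sided tail event *)

(** Producing a majorant, and not only a capacity bound, lets the majorants for [X] and [-X] be
    added later. A free [B > 0] replaces the sum of moments, which may vanish while [L] requires
    division by [B]. *)
Lemma upper_END_majorant (p K x B : R) (n : nat) (X : nat -> T -> R) :
  1 <= p <= 2 -> 0 < x -> 0 < B -> (0 < n)%N -> (forall i, H (X i)) ->
  upper_END E K X -> (forall i, (E (X i) <= 0)%E) ->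
  (\sum_(i < n) E (fun w => `|X i w| `^ p)%R <= B%:E)%E ->
  exists xi, [/\ H xi, (forall w, \1_[set w | x < \sum_(i < n) X i w] w <= xi w)
    & (E xi <= ((1 + K * expR 1) * x `^ (- p) * B)%:E)%E].
Proof.
move=> p12 x0 B0 n0 HX [K1 hK] EX0 EB.
have xp0 : 0 < x `^ p by rewrite powR_gt0.
have xNp0 : 0 < x `^ (- p) by rewrite powR_gt0.
have e0 : 0 < expR 1 :> R by exact: expR_gt0.
have Ke0 : 0 <= K * expR 1 by rewrite mulr_ge0 ?ltW// (lt_le_trans ltr01).
have [Bx|xB] := leP (x `^ p) B.
  exists (fun=> 1); split; first exact: (rvspace_cst HH).
    by move=> w; rewrite indicE; case: (_ \in _).
  rewrite (sle_cst hE) lee_fin -mulrA.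
  have : 1 <= x `^ (- p) * B by rewrite powRN ler_pdivlMl// mulr1.
  nra.
pose L := ln (x `^ p / B).
have xpB : 1 < x `^ p / B by rewrite ltr_pdivlMr// mul1r.
have L0 : 0 < L by rewrite ln_gt0.
have eL : expR L = x `^ p / B by rewrite lnK// posrE; lra.
have eLN : expR (- L) = x `^ (- p) * B by rewrite expRN eL invf_div powRN mulrC.
have HXp i : H (fun w => `|X i w| `^ p) by exact: rvspace_norm_powR.
have EXp0 i : (0 <= E (fun w => `|X i w| `^ p)%R)%E.
  by apply: sle_ge0 => // w; exact: powR_ge0.
(* For [i < n] the moment is nonnegative and at most the whole sum, hence finite, so [fine] loses
   nothing at the indices used. *)
pose e (i : nat) := fine (E (fun w => `|X i w| `^ p)).
have eE (i : 'I_n) : E (fun w => `|X i w| `^ p) = (e i)%:E.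
  rewrite /e fineK// ge0_fin_numE//; apply: le_lt_trans (ltry B).
  apply: le_trans EB; rewrite (bigD1 i)//= leeDl//.
  by apply: sume_ge0 => j _.
have sum_e : \sum_(i < n) e i <= B.
  by rewrite -lee_fin -sumEFin; under eq_bigr do rewrite -eE.
pose f (t : R) := expR (L * Num.min (t / x) 1).
have f_lip : bounded_lipschitz f by apply: bounded_lipschitz_expR_minr => //; exact: ltW.
have f0 t : 0 <= f t by exact: expR_ge0.
have f_homo : {homo f : s t / s <= t}.
  move=> s t st; rewrite /f ler_expR ler_pM2l//.
  have st' : s / x <= t / x by rewrite ler_pM2r ?invr_gt0.
  by rewrite le_min !ge_min st' lexx orbT.
have HfX i : H (fun w => f (X i w)) by exact: (rvspace_lipschitz HH).
pose P w := \prod_(i < n) f (X i w).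
have HP : H P by apply: (rvspace_prod HH) => i.
have P0 w : 0 <= P w by apply: prodr_ge0.
have EP : (E P <= (K * expR 1)%:E)%E.
  apply: (le_trans (hK n (fun=> f) n0 _)); first by move=> i; split.
  rewrite EFinM; apply: lee_wpmul2l; first by rewrite lee_fin; lra.
  apply: (@le_trans _ _ (\prod_(i < n) expR (e i / B))%:E).
    apply: prode_le_EFin => i; rewrite sle_ge0//=.
    apply: (le_trans (sle_expR_minr p12 L0 x0 (HX i) (EX0 i) (eE i))).
    (* Since [expR L = x^p / B], the exponent [expR L * x^(-p) * e i] is exactly [e i / B]. *)
    rewrite eL powRN lee_fin ler_expR le_eqVlt; apply/orP; left; apply/eqP.
    by field; rewrite !gt_eqF.
  by rewrite -expR_sum lee_fin ler_expR -mulr_suml ler_pdivrMr// mul1r.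
pose S w := \sum_(i < n) `|X i w| `^ p.
have HS : H S by apply: (rvspace_sum HH (F := fun i w => `|X i w| `^ p)) => i.
have S0 w : 0 <= S w by apply: sumr_ge0 => i _; exact: powR_ge0.
have ES : (E S <= B%:E)%E.
  apply: le_trans EB.
  by apply: (sle_sum (F := fun i w => `|X i w| `^ p)) => // i w; exact: powR_ge0.
have HxS : H (fun w => x `^ (- p) * S w) by exact: rvspaceZ.
have HLP : H (fun w => expR (- L) * P w) by exact: rvspaceZ.
exists (fun w => x `^ (- p) * S w + expR (- L) * P w); split.
- exact: rvspaceD.
- move=> w; have xS0 : 0 <= x `^ (- p) * S w by exact: (mulr_ge0 (ltW xNp0) (S0 w)).
  have LP0 : 0 <= expR (- L) * P w by exact: (mulr_ge0 (expR_ge0 _) (P0 w)).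
  rewrite indicE; case: (boolP (w \in _)); last by move=> _; rewrite addr_ge0.
  rewrite inE /= => xX.
  (* If some [X i] exceeds [x], its p-th power alone makes the first summand at least 1. Otherwise
     no truncation is active, the product equals the exponential of [L / x] times the sum, and this
     exceeds [expR L]. *)
  have [/existsP[i xi]|/existsPn small] := boolP [exists i : 'I_n, x < X i w].
    suff : 1 <= x `^ (- p) * S w by lra.
    rewrite powRN ler_pdivlMl// mulr1 /S (bigD1 i)//=.
    rewrite -[leLHS]addr0 lerD//; last by apply: sumr_ge0 => j _; exact: powR_ge0.
    case/andP: p12 => p1 p2.
    apply: ge0_ler_powR; rewrite ?nnegrE//; [lra|lra|].
    by rewrite (le_trans (ltW xi))// ler_norm.
  suff : 1 <= expR (- L) * P w by lra.
  rewrite expRN ler_pdivlMl ?expR_gt0// mulr1 /P.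
  rewrite (eq_bigr (fun i : 'I_n => expR (L * (X i w / x)))); last first.
    move=> i _; rewrite /f min_l// ler_pdivrMr// mul1r leNgt; exact: small.
  rewrite -expR_sum ler_expR -mulr_sumr -mulr_suml ler_peMr ?ltW//.
  by rewrite ltr_pdivlMr// mul1r.
have ExS : (E (fun w => x `^ (- p) * S w)%R <= (x `^ (- p) * B)%:E)%E.
  by rewrite (sle_homog hE)// EFinM lee_wpmul2l// lee_fin ltW.
have ELP : (E (fun w => expR (- L) * P w)%R <= (expR (- L) * (K * expR 1))%:E)%E.
  by rewrite (sle_homog hE) ?expR_gt0// EFinM lee_wpmul2l// lee_fin expR_ge0.
apply: (le_trans (sle_subadd_fin HxS HLP _)).
  rewrite ge0_fin_numE; last by apply: sle_ge0 => // w; rewrite mulr_ge0 ?expR_ge0.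
  exact: le_lt_trans ELP (ltry _).
apply: (le_trans (leeD ExS ELP)).
rewrite -EFinD lee_fin eLN le_eqVlt; apply/orP; left; apply/eqP; ring.
Qed.

(** * From majorants to the capacity *)

(** For finite [S], take [B = S + eps / c], which is positive even if [S = 0] and costs only [eps];
    then let [eps] tend to 0. For infinite [S] the right side is infinite. *)
Lemma upper_capacity_le_lim (A : set T) (c C : R) (S : \bar R) :
  0 < c -> c <= C -> (0 <= S)%E ->
  (forall B, 0 < B -> (S <= B%:E)%E -> exists xi, [/\ H xi,
    (forall w, \1_A w <= xi w) & (E xi <= (c * B)%:E)%E]) ->
  (upper_capacity H E A <= C%:E * S)%E.
Proof.
move=> c0 cC; have C0 : 0 < C by lra.
case: S => [s| |] //; last by move=> *; rewrite gt0_muley ?leey ?lte_fin.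
rewrite lee_fin => s0 hB; rewrite -EFinM; apply/lee_addgt0Pr => eps eps0.
have ec0 : 0 < eps / c by rewrite divr_gt0.
have [||xi [Hxi Axi Exi]] := hB (s + eps / c); [lra|by rewrite lee_fin; lra|].
apply: (@le_trans _ _ (E xi)); first by apply: ereal_inf_lbound; exists xi.
apply: (le_trans Exi); rewrite -EFinD lee_fin mulrDr lerD ?ler_wpM2r//.
by rewrite mulrCA divff ?mulr1// gt_eqF.
Qed.

End sublinear_expectation.

(** Reflecting a nondecreasing test function by [t -> -t] makes it nonincreasing and preserves its
    bound and Lipschitz constant. *)
Lemma upper_END_opp d (T : measurableType d) (R : realType)
    (E : (T -> R) -> \bar R) (K : R) (X : nat -> T -> R) :
  lower_END E K X -> upper_END E K (fun i w => - X i w).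
Proof.
move=> [K1 hK]; split=> // n f n0 hf.
apply: (hK n (fun i t => f i (- t)) n0) => i.
have [[C [C0 fb fl]] f0 fm] := hf i; split => //.
  exists C; split=> // s t; apply: (le_trans (fl _ _)).
  by rewrite -opprD normrN.
by move=> s t st; apply: fm; rewrite lerN2.
Qed.

(** * The one-sided and two-sided tail bounds *)

Theorem theorem2p2 (d : measure_display) (T : measurableType d) (R : realType)
    (H : set (T -> R)) (E : (T -> R) -> \bar R)
    (hE : is_sublinear_expectation_space H E)
    (p : R) (hp : 1 < p <= 2) :
  (forall (K : R) (X : nat -> T -> R),
     (forall i, H (X i)) ->
     upper_END E K X ->
     (forall i, (E (X i) <= 0)%E) ->
     forall (x : R) (n : nat), 0 < x -> (0 < n)%N ->
       (upper_capacity H E [set w | x < \sum_(i < n) X i w]%R <=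
          (4 `^ p * (1 + K * expR 1) * x `^ (- p))%R%:E *
          \sum_(i < n) E (fun w => `|X i w| `^ p)%R)%E)
  /\
  (forall (K : R) (X : nat -> T -> R),
     (forall i, H (X i)) ->
     END E K X ->
     (forall i, E (X i) = 0%E /\ conj_expectation E (X i) = 0%E) ->
     forall (x : R) (n : nat), 0 < x -> (0 < n)%N ->
       (upper_capacity H E [set w | x < `|\sum_(i < n) X i w|]%R <=
          (2 `^ (2 * p + 1) * (1 + K * expR 1) * x `^ (- p))%R%:E *
          \sum_(i < n) E (fun w => `|X i w| `^ p)%R)%E).
Proof.
have p12 : 1 <= p <= 2 by case/andP: hp => p1 ->; rewrite ltW.
have sum_ge0 (X : nat -> T -> R) n : (forall i, H (X i)) ->
    (0 <= \sum_(i < n) E (fun w => `|X i w| `^ p)%R)%E.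
  move=> HX; apply: sume_ge0 => i _; apply: (sle_ge0 hE) => [|w].
    exact: (rvspace_norm_powR (sle_space hE)).
  exact: powR_ge0.
have c_gt0 (K x : R) : 1 <= K -> 0 < x -> 0 < (1 + K * expR 1) * x `^ (- p).
  move=> K1 x0; rewrite mulr_gt0 ?powR_gt0//.
  have := expR_gt0 (1 : R); nra.
have four_ge1 : 1 <= 4 `^ p :> R.
  by rewrite -[leLHS](powRr0 4) ler_powR//; lra.
split=> [K X HX XE EX0 x n x0 n0|K X HX [XU XL] EX0 x n x0 n0].
  have K1 : 1 <= K by case: XE.
  have c0 := c_gt0 K x K1 x0.
  apply: (upper_capacity_le_lim (c := (1 + K * expR 1) * x `^ (- p))) => //.
  - by rewrite -[leRHS]mulrA ler_peMl// ltW.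
  - exact: sum_ge0.
  by move=> B B0 SB; apply: (upper_END_majorant hE).
have K1 : 1 <= K by case: XU.
have c0 := c_gt0 K x K1 x0.
(* The factor 2 counts the two one-sided majorants; the target constant is larger because
   [2^(2p+1) = 4^p * 2] and [4^p >= 1]. *)
apply: (upper_capacity_le_lim (c := 2 * ((1 + K * expR 1) * x `^ (- p)))).
- by rewrite mulr_gt0.
- have -> : 2 `^ (2 * p + 1) = 4 `^ p * 2 :> R.
    rewrite powRD ?powRr1// ?powRrM; last by apply/implyP => _; rewrite pnatr_eq0.
    by rewrite powR_mulrn// -natrX.
  by rewrite -!mulrA ler_peMl// ltW// mulr_gt0.
- exact: sum_ge0.
move=> B B0 SB.
have [xi [Hxi Axi Exi]] : exists xi, [/\ H xi,
    (forall w, \1_[set w | x < \sum_(i < n) X i w] w <= xi w)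
    & (E xi <= ((1 + K * expR 1) * x `^ (- p) * B)%:E)%E].
  by apply: (upper_END_majorant hE) => // i; rewrite (EX0 i).1.
have HN i : H (fun w => - X i w).
  have -> : (fun w => - X i w) = (fun w => -1 * X i w).
    by apply/funext => w; rewrite mulN1r.
  exact: (rvspaceZ (sle_space hE)).
have [eta [Heta Aeta Eeta]] : exists xi, [/\ H xi,
    (forall w, \1_[set w | x < \sum_(i < n) - X i w] w <= xi w)
    & (E xi <= ((1 + K * expR 1) * x `^ (- p) * B)%:E)%E].
  apply: (upper_END_majorant hE (X := fun i w => - X i w)) => //.
  - exact: upper_END_opp.
  (* The vanishing conjugate expectation says precisely that [-X i] has expectation 0. *)
  - by move=> i; rewrite -[E _]oppeK -/(conj_expectation E (X i)) (EX0 i).2 oppe0.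
  - by under eq_bigr do under eq_fun do rewrite normrN.
have nonneg (A : set T) (z : T -> R) : (forall w, \1_A w <= z w) -> forall w, 0 <= z w.
  by move=> Az w; apply: le_trans (Az w); rewrite indicE.
have xi0 := nonneg _ _ Axi; have eta0 := nonneg _ _ Aeta.
(* The two-sided event is the union of the upper tails of the sums of [X] and of [-X]. Both
   majorants are nonnegative, so their sum is at least 1 on either tail. *)
exists (fun w => xi w + eta w); split.
- exact: (rvspaceD (sle_space hE)).
- move=> w; have := xi0 w; have := eta0 w; rewrite indicE.
  case: (boolP (w \in _)) => [|_] /=; last by lra.
  rewrite inE /= ltr_normr -sumrN => /orP[x_lt|x_lt].
    by have := Axi w; rewrite indicE mem_set//=; lra.
  by have := Aeta w; rewrite indicE mem_set//=; lra.
apply: (le_trans (sle_subadd_fin hE Hxi Heta _)).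
  by rewrite ge0_fin_numE ?(sle_ge0 hE)//; exact: le_lt_trans Eeta (ltry _).
apply: (le_trans (leeD Exi Eeta)); rewrite -EFinD lee_fin; lra.
Qed.
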